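(* The following problem is undecidable: given a one-counter automaton $\mathcal{A}$, decide whether $\mathcal{A}$ is history-deterministic.
   Context: A one-counter automaton (OCA) is $\mathcal{A}=(Q,\Sigma,\Delta,q_0,F)$ with $Q$ finite, $\Sigma$ finite, $q_0\in Q$, $F\subseteq Q$, and $\Delta\subseteq Q\times\{\mathrm{zero},\neg\mathrm{zero}\}\times\Sigma\times\{-1,0,1\}\times Q$. From configuration $(q,m)\in Q\times\mathbb{N}$ reading $a$: if $m>0$ a transition $(q,\neg\mathrm{zero},a,d,q')$ leads to $(q',m+d)$; if $m=0$ a transition $(q,\mathrm{zero},a,d,q')$ with $d\in\{0,1\}$ leads to $(q',m+d)$. Runs start at $(q_0,0)$, are accepting if the last state is in $F$, and $\mathcal{L}(\mathcal{A})$ is the set of words with an accepting run. The letter game: positions $(c,w)$, start $((q_0,0),\varepsilon)$; each round Adam picks $a\in\Sigma$, Eve picks a transition $c\xrightarrow{a}c'$ available at $c$. If Eve has none and $wa$ is a prefix of a word in $\mathcal{L}(\mathcal{A})$, Eve loses; if $wa\in\mathcal{L}(\mathcal{A})$ but the state of $c'$ is not in $F$, Adam wins; otherwise play continues from $(c',wa)$, and Eve wins infinite plays. $\mathcal{A}$ is history-deterministic if Eve has a winning strategy in the letter game. *)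

(* Defs.v *)
From mathcomp Require Import all_boot all_algebra.
Import GRing.Theory Num.Theory.
Set Implicit Arguments. Unset Strict Implicit. Unset Printing Implicit Defensive.
Local Open Scope ring_scope.

(** * One-counter automata, concretely represented (so that they can be encoded).
    States are 0 .. nQ-1, letters are 0 .. nS-1 (Sigma = {0,..,nS-1}).
    A transition (q, z, a, d, q') : z = true means guard "zero",
    z = false means guard "not zero"; d is the counter update. *)
Definition trans := (nat * bool * nat * int * nat)%type.
Definition oca := (nat * nat * nat * seq nat * seq trans)%type.

Definition nQ (A : oca) : nat := A.1.1.1.1.
Definition nS (A : oca) : nat := A.1.1.1.2.
Definition q0 (A : oca) : nat := A.1.1.2.
Definition finals (A : oca) : seq nat := A.1.2.
Definition Delta (A : oca) : seq trans := A.2.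

Definition t_src (t : trans) : nat := t.1.1.1.1.
Definition t_zero (t : trans) : bool := t.1.1.1.2.
Definition t_letter (t : trans) : nat := t.1.1.2.
Definition t_dir (t : trans) : int := t.1.2.
Definition t_tgt (t : trans) : nat := t.2.

Definition wf_oca (A : oca) : bool :=
  [&& (q0 A < nQ A)%N,
      all (fun q => (q < nQ A)%N) (finals A) &
      all (fun t => [&& (t_src t < nQ A)%N, (t_letter t < nS A)%N,
                        (t_tgt t < nQ A)%N &
                        t_dir t \in [:: -1; 0; 1]]) (Delta A)].

Definition config := (nat * nat)%type.

(** One step c --a--> c'.  The guard must be "zero" iff the counter is 0;
    the new counter value is m + d (as a natural number, so a decrement at
    counter 0 is impossible, matching d ∈ {0,1} for zero transitions). *)
Definition step (A : oca) (c : config) (a : nat) (c' : config) : Prop :=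
  exists2 t, t \in Delta A &
    [/\ t_src t = c.1, t_zero t = (c.2 == 0)%N, t_letter t = a,
        t_tgt t = c'.1 & (c'.2%:Z = c.2%:Z + t_dir t)].

Inductive run (A : oca) : config -> seq nat -> config -> Prop :=
| run_nil c : run A c [::] c
| run_cons c a c1 w c' : step A c a c1 -> run A c1 w c' -> run A c (a :: w) c'.

Definition init_config (A : oca) : config := (q0 A, 0%N).

Definition lang (A : oca) (w : seq nat) : Prop :=
  exists2 c, run A (init_config A) w c & c.1 \in finals A.

Definition prefix_lang (A : oca) (w : seq nat) : Prop :=
  exists v, lang A (w ++ v).

(** * The letter game.
    A (deterministic) strategy of Eve maps the word w·a read so far to the
    configuration she moves to (the transition she picks).  Since the play is
    determined by Adam's letters and Eve's strategy, the current position after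
    Adam has played w is (conf s w, w). *)
Definition strategy := seq nat -> config.

Definition conf (A : oca) (s : strategy) (w : seq nat) : config :=
  if w is [::] then init_config A else s w.

Definition reaches (A : oca) (s : strategy) (w : seq nat) : Prop :=
  forall i, (i < size w)%N ->
    step A (conf A s (take i w)) (nth 0%N w i) (s (take i.+1 w)).

(** Round from position (conf s w, w) after Adam picks a is fine for Eve:
    either Eve makes a legal move to c' (and then, if w·a ∈ L(A), the state
    of c' must be final; otherwise the play continues), or Eve has no move
    at all and w·a is not a prefix of a word of L(A) (the play then ends
    without Eve losing). *)
Definition round_ok (A : oca) (s : strategy) (w : seq nat) (a : nat) : Prop :=
  let c := conf A s w in
  let c' := s (rcons w a) in
  (step A c a c' /\ (lang A (rcons w a) -> c'.1 \in finals A))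
  \/ ((forall c'', ~ step A c a c'') /\ ~ prefix_lang A (rcons w a)).

Definition winning (A : oca) (s : strategy) : Prop :=
  forall w a, all (fun b => (b < nS A)%N) w -> (a < nS A)%N ->
    reaches A s w -> round_ok A s w a.

Definition history_deterministic (A : oca) : Prop :=
  exists s : strategy, winning A s.

(** * Computability: Minsky (counter/register) machines.
    Registers are indexed by nat; a program halts when the program counter
    leaves the program. *)
Inductive instr :=
| Inc (r j : nat)          (* R[r]++ ; goto j *)
| Dec (r j k : nat).       (* if R[r] = 0 then goto k else R[r]-- ; goto j *)

Definition mstate := (nat * (nat -> nat))%type.

Definition upd (R : nat -> nat) (r v : nat) : nat -> nat :=
  fun i => if i == r then v else R i.

Definition mstep (p : seq instr) (s : mstate) : mstate :=
  let: (pc, R) := s in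
  if (pc < size p)%N then
    match nth (Inc 0 0) p pc with
    | Inc r j => (j, upd R r (R r).+1)
    | Dec r j k => if R r == 0%N then (k, R) else (j, upd R r (R r).-1)
    end
  else s.

Definition minit (x : nat) : mstate := (0%N, fun i => if i == 0%N then x else 0%N).

(** p decides the property P of (well-formed) OCAs, given as input the
    standard (computable, injective) encoding [pickle A] of the OCA:
    on every such input p halts, with register 0 equal to 1 iff P A. *)
Definition decides (p : seq instr) (P : oca -> Prop) : Prop :=
  forall A : oca, wf_oca A ->
    exists n, let s := iter n (mstep p) (minit (pickle A)) in
      (size p <= s.1)%N /\ (s.2 0%N = 1%N <-> P A).

(* Main.v *)
(** A two-checker game.  Code the registers of a Minsky machine as one number
    n = p0^R0 p1^R1 ... with distinct primes; a step then replaces n = u c + r by v c + r, where u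
    depends on the program counter and v and the next counter on it and on r.
    A run is written as a word of headers (program counters), each followed by
    n in unary, and one counter checks one step out of two.  In the automaton,
    the first letter lets Eve choose between a copy ("claim") that checks the
    odd steps and accepts when a correct run halts, and a copy ("refute") that
    checks the even steps, accepts everything once it has seen an error, and is
    stuck exactly when it has checked a run that halts.  Every prefix is
    accepted by the second copy as long as it is alive, so Eve must choose it,
    and she then loses exactly if the machine halts.

    If p decided history-determinism, consider the machine that computes the
    code of its own automaton, runs p on it, and halts iff p answers 1.  The
    automaton depends on that machine through the numbers N, F, D (bound on the
    states, code of the final states, code of the transitions), and the initial
    value X = p0^N p1^F p2^D is enforced by a chain of X further states; so the
    machine finds N, F, D in its registers and only has to add the chain. *)
Require Import Defs.
From mathcomp Require Import all_boot all_algebra zify.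
Set Implicit Arguments. Unset Strict Implicit. Unset Printing Implicit Defensive.

(** * Collatz-like machines and one-counter checkers *)

Record collatz := Collatz {
  clen : nat;
  modulus : nat -> nat;
  factor : nat -> nat -> nat;
  next : nat -> nat -> nat }.

(** Adding the remainder back lets a failed divisibility test, with factor equal to modulus, leave
    the number unchanged. *)
Definition collatz_step (C : collatz) (x : nat * nat) : nat * nat :=
  let r := x.2 %% modulus C x.1 in
  (next C x.1 r, factor C x.1 r * (x.2 %/ modulus C x.1) + r).

Definition collatz_halts (C : collatz) (x : nat * nat) : Prop :=
  exists k, clen C <= (iter k (collatz_step C) x).1.

(** By [factor_gt], r is the remainder of the new value modulo the factor, which a checker can test;
    the bounds by M keep the set of checker states finite. *)
Record collatz_wf (C : collatz) (M : nat) : Prop := CollatzWf {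
  modulus_gt0 : forall l, 0 < modulus C l;
  modulus_le : forall l, modulus C l <= M;
  factor_gt : forall l r, r < modulus C l -> r < factor C l r;
  factor_le : forall l r, factor C l r <= M;
  next_le : forall l r, next C l r <= clen C }.

(* A run (l_0, n_0), (l_1, n_1), ... is written as the word
   l_0.+1 0^n_0 l_1.+1 0^n_1 ...; one counter suffices to check every other step. *)
Definition ctl := (nat * nat + nat * nat * nat)%type.
Definition up (l r : nat) : ctl := inl (l, r).
Definition down (v r t : nat) : ctl := inr (v, r, t).

Inductive outcome := Err | Halt | Go of int & ctl.

(** In [up l r] the counter and r are the quotient and the remainder of the letters read so far by
    the modulus, and the next header is checked. In [down v r t] the counter drops once every v
    letters, and the block may end only at counter 0 with t = r; which header follows is left to the
    other checker. *)
Definition verdict (C : collatz) (s : ctl) (z : bool) (a : nat) : outcome :=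
  match s, a with
  | inl (l, r), 0 =>
      if r.+1 < modulus C l then Go 0%R (up l r.+1) else Go 1%R (up l 0)
  | inl (l, r), k.+1 =>
      if k != next C l r then Err
      else if k < clen C then Go 0%R (down (factor C l r) r 0) else Halt
  | inr (v, r, t), 0 =>
      if t.+1 < v then Go 0%R (down v r t.+1)
      else if z then Err else Go (- 1)%R (down v r 0)
  | inr (v, r, t), k.+1 =>
      if ~~ (z && (t == r)) then Err
      else if k < clen C then Go 0%R (up k 0) else Halt
  end.

Definition move (m : nat) (d : int) : nat := absz (m%:Z + d)%R.

Lemma move0 m : move m 0 = m. Proof. by rewrite /move; lia. Qed.
Lemma move1 m : move m 1 = m.+1. Proof. by rewrite /move; lia. Qed.
Lemma moveN1 m : move m.+1 (-1) = m. Proof. by rewrite /move; lia. Qed.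

(** [Halt] must fall exactly on the last letter, so the words form a prefix-free set. *)
Fixpoint halts (C : collatz) (s : ctl) (m : nat) (w : seq nat) : Prop :=
  if w is a :: w' then
    match verdict C s (m == 0) a with
    | Err => False
    | Halt => w' = [::]
    | Go d s' => halts C s' (move m d) w'
    end
  else False.

Lemma halts_cons C s m a w : halts C s m (a :: w) =
  match verdict C s (m == 0) a with
  | Err => False
  | Halt => w = [::]
  | Go d s' => halts C s' (move m d) w
  end.
Proof. by []. Qed.

Lemma verdict_dir C s m a d s' : verdict C s (m == 0) a = Go d s' ->
  (d \in [:: -1; 0; 1])%R /\ (m%:Z + d = (move m d)%:Z)%R.
Proof.
rewrite /move; case: s => [[l r]|[[v r] t]]; case: a => [|k] /=.
- by case: ifP => _ [<- _].
- by case: ifP => // _; case: ifP => // _ [<- _].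
- by case: ifP => [_ [<- _]|_] //; case: eqP => // m0 [<- _]; split=> //; lia.
- by case: ifP => // _; case: ifP => // _ [<- _].
Qed.

Lemma verdict_halt C s z a : verdict C s z a = Halt -> clen C < a.
Proof.
case: s => [[l r]|[[v r] t]]; case: a => [|k] //=; do ?case: ifP => //.
  by move=> h _ _; rewrite ltnS leqNgt h.
by move=> h _ _; rewrite ltnS leqNgt h.
Qed.

Lemma verdict_header_go C s z a d s' : clen C < a -> verdict C s z a <> Go d s'.
Proof.
by case: s => [[l r]|[[v r] t]]; case: a => [|k] //=; rewrite ltnS leqNgt;
  do ?case: ifP.
Qed.

(** A header outside the program yields only [Err] or [Halt]. In the game this shows that a letter
    on which the refute copy halts ends every word that the claim copy accepts. *)
Lemma halts_header C s m w1 a w2 :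
  clen C < a -> halts C s m (w1 ++ a :: w2) -> w2 = [::].
Proof.
move=> ha; elim: w1 s m => [|b w1 IH] s m /=.
  by case E: verdict => [||d s'] //; case: (verdict_header_go ha E).
case: verdict => // [|d s']; first by case: w1 {IH}.
exact: IH.
Qed.

(** * Correctness of the two checkers reading the same word *)

Lemma divmodS k u : 0 < u ->
  if (k %% u).+1 < u then (k.+1 %/ u = k %/ u) /\ (k.+1 %% u = (k %% u).+1)
  else (k.+1 %/ u = (k %/ u).+1) /\ (k.+1 %% u = 0).
Proof.
move=> u0; have kE := divn_eq k u; have := ltn_pmod k u0.
set q := k %/ u in kE *; set r := k %% u in kE * => ru; case: ifP => h.
  by rewrite kE -addnS divnMDl // modnMDl divn_small // modn_small // addn0.
have -> : k.+1 = q.+1 * u by nia.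
by rewrite mulnK // modnMl.
Qed.

Lemma verdict_up_tick C l k m : 0 < modulus C l -> m = k %/ modulus C l ->
  exists d, verdict C (up l (k %% modulus C l)) (m == 0) 0
              = Go d (up l (k.+1 %% modulus C l))
            /\ move m d = k.+1 %/ modulus C l.
Proof.
move=> u0 ->; have := divmodS k u0; rewrite /=.
by case: ifP => _ [-> ->];
  [exists 0%R; rewrite move0 | exists 1%R; rewrite move1].
Qed.

Lemma verdict_down_tick C c v r k : 0 < v -> k %/ v <= c ->
  if k.+1 %/ v <= c then
    exists d, verdict C (down v r (k %% v)) (c - k %/ v == 0) 0
                = Go d (down v r (k.+1 %% v))
              /\ move (c - k %/ v) d = c - k.+1 %/ v
  else verdict C (down v r (k %% v)) (c - k %/ v == 0) 0 = Err.
Proof.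
move=> v0 kc; have := divmodS k v0; rewrite /=.
case: ifP => _ [-> ->]; first by rewrite kc; exists 0%R; rewrite move0.
move: (k %/ v) kc => q qc; case: ifP => h; last by rewrite ifT //; lia.
have -> : c - q = (c - q.+1).+1 by lia.
by exists (-1)%R; rewrite moveN1.
Qed.

Lemma down_done v r c k : 0 < v -> r < v -> k %/ v <= c ->
  ((c - k %/ v == 0) && (k %% v == r)) = (k == v * c + r).
Proof.
move=> v0 rv kc; apply/idP/eqP => [/andP[/eqP h /eqP <-]|->].
  have -> : c = k %/ v by lia.
  by rewrite mulnC -divn_eq.
by rewrite mulnC divnMDl // modnMDl divn_small // modn_small // addn0 subnn !eqxx.
Qed.

(* The invariant of the two checkers reading the same word: one of them
   processes the current block while the other one compares its length with
   the value n of the run. *)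
Lemma halts_sound C M (wfC : collatz_wf C M) l n k c v r w :
  r < v -> k %/ v <= c -> n = v * c + r ->
  halts C (up l (k %% modulus C l)) (k %/ modulus C l) w ->
  halts C (down v r (k %% v)) (c - k %/ v) w ->
  collatz_halts C (l, n).
Proof.
elim: w l n k c v r => [|a w IH] l n k c v r // rv kc nE.
have v0 : 0 < v by lia.
have u0 := modulus_gt0 wfC l.
case: a => [|b].
  rewrite halts_cons.
  have [d [-> ->]] := verdict_up_tick u0 (erefl (k %/ modulus C l)).
  move=> hup; have := verdict_down_tick C r v0 kc.
  rewrite halts_cons.
  case: ifP => [kc' [d' [-> ->]]|_ -> //].
  exact: IH hup.
(* Both checkers survive a header only if the block has length n and b is the next program counter;
   their roles are then exchanged. *)
have dd := down_done v0 rv kc; rewrite /= dd -nE.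
case: eqP => //= bE; case: eqP => //= kn.
have c0 : c - k %/ v = 0 by move: dd; rewrite -nE kn eqxx => /andP[/eqP].
rewrite {}bE {}c0 {}kn in IH * => {b}.
case: ifP => [hlt | hge _ _]; last by exists 1; rewrite /= leqNgt hge.
rewrite !move0 => hdn hup.
have [j] : collatz_halts C (collatz_step C (l, n)).
  apply: (IH _ _ 0 (n %/ modulus C l) (factor C l (n %% modulus C l))
                  (n %% modulus C l)) => //.
  - by apply: (factor_gt wfC); rewrite ltn_mod.
  - by rewrite div0n.
  - by rewrite div0n mod0n.
  - by rewrite div0n mod0n subn0.
by rewrite -iterSr => jh; exists j.+1.
Qed.

(** The missing [n - k] zeros are prepended one at a time; up to n the quotient by v stays at most
    c, so the down checker meets no error. *)
Lemma halts_complete_block C M (wfC : collatz_wf C M) l n k c v r w :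
  r < v -> n = v * c + r -> k <= n ->
  halts C (up l (n %% modulus C l)) (n %/ modulus C l) w ->
  halts C (down v r (n %% v)) (c - n %/ v) w ->
  halts C (up l (k %% modulus C l)) (k %/ modulus C l) (nseq (n - k) 0 ++ w) /\
  halts C (down v r (k %% v)) (c - k %/ v) (nseq (n - k) 0 ++ w).
Proof.
move=> rv nE kn hup hdn; have v0 : 0 < v by lia.
move Ej: (n - k) => j; elim: j k kn Ej => [|j IH] k kn Ej.
  by have -> : k = n by lia.
have bound i : i <= n -> i %/ v <= c.
  by move=> hi; rewrite -ltnS ltn_divLR //; nia.
have [||hu hd] := IH k.+1; try lia.
rewrite [nseq _ _ ++ _]/= !halts_cons.
have [d [-> ->]] := verdict_up_tick (modulus_gt0 wfC l) (erefl (k %/ modulus C l)).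
have := verdict_down_tick C r v0 (bound k kn).
by rewrite bound; [case=> d' [-> ->] | lia].
Qed.

(** Induction on the number of steps: the word is the block of n zeros, the next header, and the
    word of the remaining run with the checkers exchanged. *)
Lemma halts_complete C M N (wfC : collatz_wf C M) l n c v r :
  (clen C).+1 < N -> r < v -> n = v * c + r -> l < clen C ->
  collatz_halts C (l, n) ->
  exists w, [/\ all (fun a => a < N) w, halts C (up l 0) 0 w
               & halts C (down v r 0) c w].
Proof.
move=> LN rv nE lL [j]; elim: j l n c v r rv nE lL => [|j IH] l n c v r rv nE lL.
  by rewrite /= leqNgt lL.
rewrite iterSr => hj; have v0 : 0 < v by lia.
set l' := next C l (n %% modulus C l).
have nv : n %/ v <= c by rewrite -ltnS ltn_divLR //; nia.
have nxl : l' <= clen C := next_le wfC _ _.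
have dd : (c - n %/ v == 0) && (n %% v == r) by rewrite down_done // nE.
suff [w [wN hu hd]] : exists w, [/\ all (fun a => a < N) w,
    halts C (up l (n %% modulus C l)) (n %/ modulus C l) w
  & halts C (down v r (n %% v)) (c - n %/ v) w].
  have [] := halts_complete_block wfC rv nE (leq0n n) hu hd.
  rewrite !mod0n !div0n !subn0 => hu' hd'; exists (nseq n 0 ++ w); split=> //.
  by rewrite all_cat wN andbT all_nseq; lia.
case: (ltnP l' (clen C)) => hl; last first.
  exists [:: l'.+1]; rewrite /= eqxx dd /= (ltnNge l' (clen C)) hl /=; split=> //; lia.
have rf : n %% modulus C l < factor C l (n %% modulus C l).
  by apply: (factor_gt wfC); rewrite ltn_mod (modulus_gt0 wfC).
have [w [wN hu hd]] := IH _ _ _ _ _ rf (erefl _) hl hj.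
exists (l'.+1 :: w); rewrite /= eqxx dd /= hl !move0.
split=> //; first by rewrite wN andbT; lia.
by case/andP: dd => /eqP->.
Qed.

(** With v = 1 and r = 0 the down checker tests only that the first block has length X. *)
Lemma collatz_haltsP C M N X (wfC : collatz_wf C M) :
  0 < clen C -> (clen C).+1 < N ->
  collatz_halts C (0, X) <->
  exists w, [/\ all (fun a => a < N) w, halts C (up 0 0) 0 w
               & halts C (down 1 0 0) X w].
Proof.
move=> L0 LN; split.
  by apply: (halts_complete wfC); rewrite // mul1n addn0.
move=> [w [_ hu hd]].
apply: (@halts_sound _ _ wfC 0 X 0 X 1 0 w) => //.
- by rewrite mul1n addn0.
- by rewrite mod0n div0n.
- by rewrite mod0n div0n subn0.
Qed.
(** * The automaton and its letter game *)

Definition state := (bool * ctl + nat)%type.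
Definition claim (s : ctl) : state := inl (true, s).
Definition refute (s : ctl) : state := inl (false, s).
Definition sinit : state := inr 0.
Definition sacc : state := inr 1.
Definition ssink : state := inr 2.

(** The two copies treat [Err] and [Halt] in opposite ways. The edge from [sinit] towards the claim
    copy depends on X and is added separately as [entry]. *)
Definition delta (C : collatz) (x : state) (z : bool) (a : nat) : seq (int * state) :=
  match x with
  | inl (true, s) =>
      match verdict C s z a with
      | Err => [::]
      | Halt => [:: (0%R, sacc)]
      | Go d s' => [:: (d, claim s')]
      end
  | inl (false, s) =>
      match verdict C s z a with
      | Err => [:: (0%R, ssink)]
      | Halt => [::]
      | Go d s' => [:: (d, refute s')]
      end
  | inr 0 => if z && (a == 1) then [:: (0%R, refute (up 0 0))] else [::]
  | inr 2 => [:: (0%R, ssink)]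
  | inr _ => [::]
  end.

Definition ctls (C : collatz) (M : nat) : seq ctl :=
  [seq up l r | l <- iota 0 (clen C), r <- iota 0 M] ++
  [seq down x.1 x.2 t | x <- [seq (v, r) | v <- iota 0 M.+1, r <- iota 0 M],
                        t <- iota 0 M].

Definition states (C : collatz) (M : nat) : seq state :=
  [:: sinit; sacc; ssink] ++
  [seq inl (b, s) | b <- [:: true; false], s <- ctls C M].

(* The state [claim (down 1 0 0)] is numbered N, to be the end of the chain of
   states N + X, ..., N + 1, N which forces the first block to have length X. *)
Definition num (N : nat) (x : state) : nat :=
  if x == claim (down 1 0 0) then N else pickle x.

Definition base (C : collatz) (M N : nat) : seq trans :=
  [seq (num N x.1.1, x.1.2, x.2, dx.1, num N dx.2)
    | x <- [seq (y, a) | y <- [seq (x, z) | x <- states C M, z <- [:: true; false]],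
                         a <- iota 0 N],
      dx <- delta C x.1.1 x.1.2 x.2].

Definition accepting (C : collatz) (M N : nat) : seq nat :=
  [seq num N x | x <- [:: sacc, ssink & map refute (ctls C M)]].

Definition chain (N i : nat) : trans := (N + i.+1, true, 0, 0%R, N + i).
Definition entry (N X : nat) : trans := (pickle sinit, true, 1, 0%R, N + X).

(** X affects only the number of states, the entry edge and the chain, so the code can be computed
    from N, X and the codes of F and D. *)
Definition load (N X : nat) (F : seq nat) (D : seq trans) : oca :=
  ((N + X).+1, N, pickle sinit, F,
   entry N X :: rev [seq chain N i | i <- iota 0 X] ++ D).

Section LetterGame.

Context (C : collatz) (M N X : nat) (wfC : collatz_wf C M).
Context (L0 : 0 < clen C) (LN : (clen C).+1 < N).
Context (numN : all (fun x : state => pickle x < N) (states C M)).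

Let A := load N X (accepting C M N) (base C M N).

(** * Membership in the lists of states and transitions *)

Definition ok_ctl (s : ctl) : bool :=
  match s with
  | inl (l, r) => (l < clen C) && (r < M)
  | inr (v, r, t) => [&& v <= M, r < M & t < M]
  end.

Lemma M_gt0 : 0 < M.
Proof. by apply: leq_trans (modulus_le wfC 0); apply: modulus_gt0 wfC _. Qed.

Lemma ok_up0 : ok_ctl (up 0 0).
Proof. by rewrite /= L0 M_gt0. Qed.

Lemma ok_down0 : ok_ctl (down 1 0 0).
Proof. by rewrite /= M_gt0. Qed.

Lemma mem_ctls s : ok_ctl s -> s \in ctls C M.
Proof.
rewrite mem_cat; case: s => [[l r]|[[v r] t]].
  by case/andP=> hl hr; apply/orP; left; apply: allpairs_f; rewrite mem_iota.
case/and3P=> hv hr ht; apply/orP; right.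
apply/flatten_mapP; exists (v, r); last by apply/mapP; exists t; rewrite ?mem_iota.
by apply/allpairsP; exists (v, r); rewrite !mem_iota.
Qed.

Lemma verdict_ok s z a d s' : ok_ctl s -> verdict C s z a = Go d s' -> ok_ctl s'.
Proof.
have := M_gt0; case: s => [[l r]|[[v r] t]]; case: a => [|k] //= M0.
- move=> /andP[hl hr]; have := modulus_le wfC l.
  by case: ifP => h hM [_ <-] /=; rewrite hl //; lia.
- move=> /andP[hl hr]; case: ifP => // _; case: ifP => // hk [_ <-] /=.
  by rewrite (factor_le wfC) hr.
- move=> /and3P[hv hr ht]; case: ifP => h; first by move=> [_ <-] /=; rewrite hv hr; lia.
  by case: ifP => // _ [_ <-] /=; rewrite hv hr M0.
- by move=> _; case: ifP => // _; case: ifP => // hk [_ <-] /=; rewrite hk.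
Qed.

Lemma mem_states b s : ok_ctl s -> inl (b, s) \in states C M.
Proof.
move=> /mem_ctls hs; rewrite mem_cat; apply/orP; right.
by apply/allpairsP; exists (b, s); split=> //; case: b.
Qed.

Lemma pickle_lt x : x \in states C M -> pickle x < N.
Proof. by move/(allP numN). Qed.

Lemma num_le x : x \in states C M -> num N x <= N.
Proof. by rewrite /num; case: eqP => // _ /pickle_lt /ltnW. Qed.

Lemma num_inj : {in states C M &, injective (num N)}.
Proof.
move=> x y hx hy; rewrite /num.
have := pickle_lt hx; have := pickle_lt hy.
case: eqP => [->|_]; case: eqP => [->|_] //; try lia.
by move=> _ _; apply: (pcan_inj pickleK).
Qed.

Lemma delta_dir x m a d y : (d, y) \in delta C x (m == 0) a ->
  (d \in [:: -1; 0; 1])%R /\ (m%:Z + d = (move m d)%:Z)%R.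
Proof.
have h0 : ((0 : int) \in [:: -1; 0; 1])%R /\ (m%:Z + 0 = (move m 0)%:Z)%R.
  by rewrite move0; split=> //; lia.
case: x => [[[] s]|[|[|[|n]]]] //=.
- by case E: verdict => [||d' s'] //=; rewrite inE => /eqP[-> _] //;
    apply: verdict_dir E.
- by case E: verdict => [||d' s'] //=; rewrite inE => /eqP[-> _] //;
    apply: verdict_dir E.
- by case: ifP => // _; rewrite inE => /eqP[-> _].
- by rewrite inE => /eqP[-> _].
Qed.

Lemma baseP t : reflect
  (exists x z a d y, [/\ x \in states C M, a < N, (d, y) \in delta C x z a
                       & t = (num N x, z, a, d, num N y)])
  (t \in base C M N).
Proof.
apply: (iffP allpairsPdep) => [[[[x z] a] [[d y] [h1 h2 ->]]]|].
  exists x, z, a, d, y.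
  have [[[x1 z1] a1] [h3 ha [e1 e2 e3]]] := allpairsP h1.
  have [[x2 z2] [hx _ [e4 _]]] := allpairsP h3.
  by move: ha hx; rewrite mem_iota /= -e3 -e4 -e1.
move=> [x [z [a [d [y [hx ha hd ->]]]]]]; exists (x, z, a), (d, y); split=> //.
apply/allpairsP; exists ((x, z), a); rewrite mem_iota; split=> //.
by apply/allpairsP; exists (x, z); split=> //; case: z {hd}.
Qed.

Lemma init_state : sinit \in states C M. Proof. by []. Qed.

(** [sinit] is excluded because the entry edge leaves it; chain edges start above N, outside the
    range of [num]. *)
Lemma step_state x m a c : x \in states C M -> x != sinit ->
  step A (num N x, m) a c <->
  a < N /\ exists d y, (d, y) \in delta C x (m == 0) a /\ c = (num N y, move m d).
Proof.
move=> hx xi; split.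
  case=> t; rewrite /Delta /= inE mem_cat mem_rev => /or3P[/eqP->|/mapP[i _ ->]|].
  - by case=> /= e _ _ _ _; case/eqP: xi; apply: num_inj.
  - by case=> /= e; have := num_le hx; rewrite -e /t_src /=; lia.
  - case/baseP => [x' [z [a' [d [y [hx' ha' hd ->]]]]]].
    rewrite /t_src /t_zero /t_letter /t_tgt /t_dir /=.
    case=> /num_inj xx zE aE yE cE; rewrite xx // zE aE in hd ha'.
    split=> //; exists d, y; split=> //; case: c yE cE => c1 c2 /= -> e.
    by congr pair; case: (delta_dir hd) => _; rewrite -e; case.
case=> ha [d [y [hd ->]]]; exists (num N x, m == 0, a, d, num N y).
  rewrite /Delta /= inE mem_cat; apply/or3P; constructor 3; apply/baseP.
  by exists x, (m == 0), a, d, y.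
by split=> //=; case: (delta_dir hd).
Qed.

Lemma step_claim s m a c : ok_ctl s ->
  step A (num N (claim s), m) a c <->
  a < N /\ match verdict C s (m == 0) a with
           | Err => False
           | Halt => c = (num N sacc, m)
           | Go d s' => c = (num N (claim s'), move m d)
           end.
Proof.
move=> hs; rewrite step_state ?mem_states //=.
split=> -[-> h]; split=> //; move: h.
  case=> d [y []]; case: verdict => [||d' s'] //; rewrite inE => /eqP[-> ->] -> //.
  by rewrite move0.
case: verdict => [||d' s'] // ->.
  by exists 0%R, sacc; rewrite move0 inE.
by exists d', (claim s'); rewrite inE.
Qed.

Lemma step_refute s m a c : ok_ctl s ->
  step A (num N (refute s), m) a c <->
  a < N /\ match verdict C s (m == 0) a with
           | Err => c = (num N ssink, m)
           | Halt => False
           | Go d s' => c = (num N (refute s'), move m d)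
           end.
Proof.
move=> hs; rewrite step_state ?mem_states //=.
split=> -[-> h]; split=> //; move: h.
  case=> d [y []]; case: verdict => [||d' s'] //; rewrite inE => /eqP[-> ->] -> //.
  by rewrite move0.
case: verdict => [||d' s'] // ->.
  by exists 0%R, ssink; rewrite move0 inE.
by exists d', (refute s'); rewrite inE.
Qed.

Lemma step_sink m a c : step A (num N ssink, m) a c <-> a < N /\ c = (num N ssink, m).
Proof.
rewrite step_state //=; split=> -[-> h]; split=> //; move: h.
  by case=> d [y [+ ->]]; rewrite inE => /eqP[-> ->]; rewrite move0.
by move=> ->; exists 0%R, ssink; rewrite move0 inE.
Qed.

Lemma step_acc m a c : ~ step A (num N sacc, m) a c.
Proof. by rewrite step_state //= => -[_ [d [y []]]]. Qed.

Lemma step_init a c : step A (init_config A) a c <->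
  a = 1 /\ (c = (N + X, 0) \/ c = (num N (refute (up 0 0)), 0)).
Proof.
have iN : pickle sinit = num N sinit by [].
split.
  case=> t; rewrite /Delta /= inE mem_cat mem_rev => /or3P[/eqP->|/mapP[i _ ->]|].
  - case=> /= _ _ <- hc hd; split=> //; left.
    by case: c hc hd => c1 c2 /= <-; rewrite /t_dir /= => -[->].
  - case=> /= + _ _ _ _; rewrite /t_src /= /q0 /= => e.
    by have := num_le init_state; rewrite -iN -e; lia.
  - case/baseP => [x [z [a' [d [y [hx ha hd ->]]]]]].
    rewrite /t_src /t_zero /t_letter /t_tgt /t_dir /=.
    rewrite {1}/q0 /= iN; case=> /num_inj xE zE aE yE cE; rewrite xE // zE aE /= in hd.
    move: hd; case: eqP => // ->; rewrite inE => /eqP[dE yE']; split=> //; right.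
    by case: c yE cE => c1 c2 /= <-; rewrite yE' dE => -[->].
case=> -> [] ->.
  by exists (entry N X); rewrite ?inE ?eqxx.
move Er: (num N (refute (up 0 0))) => r.
exists (pickle sinit, true, 1, 0%R, r); last by split; exact: erefl.
rewrite iN -{}Er /Delta /= inE mem_cat; apply/or3P; constructor 3; apply/baseP.
exists sinit, true, 1, 0%R, (refute (up 0 0)); split=> //; lia.
Qed.

Lemma step_chain i a c : i < X ->
  step A (N + i.+1, 0) a c <-> a = 0 /\ c = (N + i, 0).
Proof.
move=> iX; split.
  case=> t; rewrite /Delta /= inE mem_cat mem_rev => /or3P[/eqP->|/mapP[j _ ->]|].
  - case=> /= + _ _ _ _; rewrite /t_src /= => e.
    by have := num_le init_state; rewrite -[num N sinit]/(pickle sinit) e; lia.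
  - rewrite /t_src /t_zero /t_letter /t_tgt /t_dir /= => -[e _ <- e1 e2].
    split=> //; case: c e1 e2 => c1 c2 /= <- -[->].
    by congr pair; lia.
  - case/baseP => [x [z [a' [d [y [hx ha hd ->]]]]]].
    rewrite /t_src /=; case=> /= e; have := num_le hx; lia.
case=> -> ->; exists (chain N i); last by split; exact: erefl.
rewrite /Delta /= inE mem_cat mem_rev; apply/or3P; constructor 2.
by apply/mapP; exists i; rewrite // mem_iota.
Qed.

Lemma final_state x : x \in states C M ->
  (num N x \in finals A) = (x \in [:: sacc, ssink & map refute (ctls C M)]).
Proof.
move=> hx; apply/mapP/idP => [[y hy e]|h]; last by exists x.
suff hy' : y \in states C M by rewrite (num_inj hx hy' e).
move: hy; rewrite 2!inE => /or3P[/eqP->|/eqP->|/mapP[s hs ->]] //.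
rewrite mem_cat; apply/orP; right; apply/allpairsP; by exists (false, s).
Qed.

Lemma final_claim s : ok_ctl s -> num N (claim s) \notin finals A.
Proof.
by move=> hs; rewrite final_state ?mem_states // 2!inE /=; apply/mapP => -[].
Qed.

Lemma final_refute s : ok_ctl s -> num N (refute s) \in finals A.
Proof.
move=> hs; rewrite final_state ?mem_states // 2!inE /=.
by apply: map_f; apply: mem_ctls.
Qed.

Lemma final_sink : num N ssink \in finals A.
Proof. by rewrite final_state. Qed.

Lemma final_acc : num N sacc \in finals A.
Proof. by rewrite final_state. Qed.

Lemma final_chain i : N + i \notin finals A.
Proof.
case: i => [|i]; first by rewrite addn0 (final_claim ok_down0).
apply/mapP => -[y hy e]; suff : num N y <= N by lia.
apply: num_le; move: hy; rewrite 2!inE => /or3P[/eqP->|/eqP->|/mapP[s hs ->]] //.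
by rewrite mem_cat; apply/orP; right; apply/allpairsP; exists (false, s).
Qed.

(** * Words accepted through the claim copy *)

Lemma run_consE c a w c' : run A c (a :: w) c' ->
  exists2 c1, step A c a c1 & run A c1 w c'.
Proof. by move=> h; inversion h; subst; exists c1. Qed.

Lemma run_nilE c c' : run A c [::] c' -> c' = c.
Proof. by move=> h; inversion h. Qed.

Lemma run_letters c w c' : run A c w c' -> all (fun a => a < N) w.
Proof.
elim=> // {}c a c1 w' {}c' [t ht [_ _ <- _ _]] _ /= ->; rewrite andbT.
move: ht; rewrite /Delta /= inE mem_cat mem_rev => /or3P[/eqP->|/mapP[j _ ->]|].
- by rewrite /t_letter /=; lia.
- by rewrite /t_letter /=; lia.
- by case/baseP => [x [z [a' [d [y [_ ha _ ->]]]]]].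
Qed.

Lemma run_claimP s m w : ok_ctl s -> all (fun a => a < N) w ->
  (exists2 c, run A (num N (claim s), m) w c & c.1 \in finals A) <-> halts C s m w.
Proof.
elim: w s m => [|a w IH] s m hs /=.
  by split=> // -[c /run_nilE->]; rewrite (negbTE (final_claim hs)).
case/andP=> ha hw; split.
  case=> c /run_consE[c1 /(step_claim _ _ _ hs)[_]].
  case E: verdict => [||d s'] // ->; last first.
    by move=> h1 h2; apply/IH => //; [apply: verdict_ok E | exists c].
  by case: w {IH hw} => // b w /run_consE[c2 /step_acc].
case E: verdict => [||d s'] //.
  move=> ->; exists (num N sacc, m); last exact: final_acc.
  by apply: run_cons (run_nil _ _); apply/step_claim; rewrite // E.
move=> /IH[||c hc1 hc2] //; first exact: verdict_ok E.
exists c => //; apply: run_cons hc1.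
by apply/step_claim; rewrite // E.
Qed.

(** State [N + i] at counter 0 imitates the down checker with v = 1 at counter i: a zero moves one
    state down, and a header is impossible before the end of the chain. *)
Lemma run_chainP i w : i <= X -> all (fun a => a < N) w ->
  (exists2 c, run A (N + i, 0) w c & c.1 \in finals A) <->
  halts C (down 1 0 0) i w.
Proof.
elim: i w => [|i IH] w iX hw.
  by rewrite addn0; apply: (run_claimP _ ok_down0).
case: w hw => [|a w] /=.
  by split=> // -[c /run_nilE->]; rewrite (negbTE (final_chain _)).
case/andP=> ha hw; split.
  case=> c /run_consE[c1 /(step_chain _ _ iX)[-> ->] h1 h2].
  by rewrite moveN1; apply/IH => //; [lia | exists c].
case: a ha => // _; rewrite moveN1 => /IH[||c hc1 hc2] //; first lia.
by exists c => //; apply: run_cons hc1; apply/step_chain.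
Qed.

(** * Strategies of Adam and Eve *)

Lemma reaches_rcons s u a : reaches A s (rcons u a) <->
  reaches A s u /\ step A (conf A s u) a (s (rcons u a)).
Proof.
split=> [h|[hu hs] i].
  split=> [i iu|].
    have := h i; rewrite size_rcons nth_rcons iu -cats1 !takel_cat ?(ltnW iu) //.
    by apply; apply: ltnW.
  have := h (size u); rewrite size_rcons nth_rcons ltnn eqxx ltnSn.
  rewrite -cats1 take_size_cat // take_oversize ?size_cat ?addn1 //.
  exact.
rewrite size_rcons ltnS leq_eqVlt nth_rcons => /predU1P[->|iu].
  rewrite ltnn eqxx -cats1 take_size_cat // take_oversize ?size_cat ?addn1 //.
  by rewrite cats1.
by rewrite iu -cats1 !takel_cat ?(ltnW iu) //; apply: hu.
Qed.

(** Adam spells w. The refute copy is deterministic, so Eve is led to the [Halt], where she has no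
    move although the word read would be in the language. *)
Lemma adam_wins s u t m w : winning A s -> u != [::] ->
  conf A s u = (num N (refute t), m) -> ok_ctl t ->
  all (fun a => a < N) u -> all (fun a => a < N) w ->
  reaches A s u -> halts C t m w -> ~ lang A (u ++ w).
Proof.
move=> win; elim: w u t m => [|a w IH] u t m // u0 cu ht hu /= /andP[ha hw] ru hw' hl.
have hua : all (fun a => a < N) (rcons u a) by rewrite all_rcons ha.
case: (win u a hu ha ru) => [[st _]|[_]]; last first.
  by case; exists w; rewrite cat_rcons.
have := st; rewrite cu => /(step_refute _ _ _ ht)[_].
move: hw'; case E: verdict => [||d t'] // hw' sE.
apply: (IH (rcons u a) t' (move m d)) => //.
- by case: (u).
- by rewrite -sE; case: (u) u0.
- exact: verdict_ok E.
- exact/reaches_rcons.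
- by rewrite cat_rcons.
Qed.

(** The strategy follows the refute copy; [None] stands for the sink. *)
Definition eve_next (x : option ctl * nat) (a : nat) : option ctl * nat :=
  if x.1 is Some t then
    if verdict C t (x.2 == 0) a is Go d t' then (Some t', move x.2 d) else (None, x.2)
  else x.

Definition eve_config (x : option ctl * nat) : config :=
  (num N (if x.1 is Some t then refute t else ssink), x.2).

Definition eve_ok (x : option ctl * nat) : bool :=
  if x.1 is Some t then ok_ctl t else true.

Definition eve_stuck (x : option ctl * nat) (a : nat) : Prop :=
  if x.1 is Some t then verdict C t (x.2 == 0) a = Halt else False.

Definition eve_start : option ctl * nat := (Some (up 0 0), 0).

Definition eve (w : seq nat) : config :=
  eve_config (foldl eve_next eve_start (behead w)).

(** By determinism, every run of the refute copy on an extension of w passes through the current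
    configuration; and while no error has been seen, a halting continuation yields a halting word
    from the start. *)
Definition eve_inv (w : seq nat) : Prop :=
  let x := foldl eve_next eve_start w in
  (forall v c, run A (eve_config eve_start) (w ++ v) c -> run A (eve_config x) v c) /\
  (if x.1 is Some t then
     ok_ctl t /\ (forall v, halts C t x.2 v -> halts C (up 0 0) 0 (w ++ v))
   else True).

Lemma eve_step x a : a < N -> eve_ok x ->
  step A (eve_config x) a (eve_config (eve_next x a)) \/
  eve_stuck x a.
Proof.
case: x => [[t|] m] /= ha ht; last by left; apply/step_sink.
rewrite /eve_stuck /eve_next /eve_config /=; case E: verdict => [||d t'] /=.
- by left; apply/step_refute; rewrite ?E.
- by right.
- by left; apply/step_refute; rewrite ?E.
Qed.

Lemma eve_step_uniq x a c : eve_ok x ->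
  step A (eve_config x) a c ->
  c = eve_config (eve_next x a) /\ ~ eve_stuck x a.
Proof.
case: x => [[t|] m] /= ht; last by move=> /step_sink[_ ->]; split.
rewrite /eve_stuck /eve_next /eve_config /= => /(step_refute _ _ _ ht)[_].
by case: verdict => [||d t'] // ->.
Qed.

Lemma eve_invP b w : reaches A eve (b :: w) -> b = 1 /\ eve_inv w.
Proof.
elim/last_ind: w => [|w a IH].
  rewrite -[[:: b]]/(rcons [::] b) => /reaches_rcons[_ /step_init[-> _]].
  split=> //; split=> //; split=> //; exact: ok_up0.
rewrite -rcons_cons => /reaches_rcons[/IH[-> [h1 h2]] st]; split=> //.
rewrite /conf -[eve (1 :: w)]/(eve_config (foldl eve_next eve_start w)) in st.
have h3 : eve_ok (foldl eve_next eve_start w).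
  by rewrite /eve_ok; case: _.1 h2 => // t [].
have [_ nh] := eve_step_uniq h3 st.
rewrite /eve_inv foldl_rcons; move: (foldl _ _ _) h1 h2 h3 nh {st} => x h1 h2 h3 nh.
split=> [v c|].
  by rewrite cat_rcons => /h1 /run_consE[c1 /(eve_step_uniq h3)[-> _]].
case: x h2 nh {h1 h3} => [[t|] m] //= [ht hv].
rewrite /eve_stuck /eve_next /=; case E: verdict => [||d t'] //= _.
split=> [|v hv']; first exact: verdict_ok E.
by rewrite cat_rcons; apply: hv; rewrite halts_cons E.
Qed.

(** A word on which both checkers halt is accepted through the claim copy and strands Eve in the
    refute copy. Without such a word, Eve in the refute copy is stuck only when no accepted word
    extends the play. *)
Lemma load_hdP : history_deterministic A <->
  ~ exists w, [/\ all (fun a => a < N) w, halts C (up 0 0) 0 w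
                 & halts C (down 1 0 0) X w].
Proof.
have N1 : 1 < N by lia.
have st0 : step A (init_config A) 1 (eve_config eve_start).
  by apply/step_init; split=> //; right.
split=> [[s win] [w [hw hu hd]]|nh].
  have lw : lang A (1 :: w).
    have [c h1 h2] := (run_chainP (leqnn X) hw).2 hd.
    by exists c => //; apply: run_cons h1; apply/step_init; split=> //; left.
  case: (win [::] 1 isT N1) => // [[st fin]|[/(_ _ st0)] //].
  (* The word 1 is accepted, since [refute (up 0 0)] is final, while no chain state is final: a
     winning Eve must enter the refute copy. *)
  have s1 : s [:: 1] = (num N (refute (up 0 0)), 0).
    have /fin f1 : lang A [:: 1].
      exists (eve_config eve_start); last exact: (final_refute ok_up0).
      exact: run_cons st0 (run_nil _ _).
    case/step_init: st => _ [e|e]; last exact: e.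
    by exfalso; move: f1; rewrite [rcons _ _]/= e; apply/negP/final_chain.
  apply: (@adam_wins s [:: 1] _ _ w win _ s1 ok_up0 _ hw _ hu lw); [by []|by rewrite /= N1|].
  by apply/(reaches_rcons s [::] 1); split.
exists eve => w a hw ha; case: w hw => [|b w] hw rw.
  case: (eqVneq a 1) => [->|a1].
    by left; split; [exact: st0 | move=> _; exact: (final_refute ok_up0)].
  right; split=> [c /step_init[/eqP]|[v [c /run_consE[c1 /step_init[/eqP]]]]];
    by rewrite (negbTE a1).
have [b1 [h1 h2]] := eve_invP rw; rewrite b1 in hw rw * => {b b1}.
rewrite /round_ok /conf -[eve (rcons _ _)]/(eve_config (foldl _ _ (rcons w a))).
rewrite -[eve (1 :: w)]/(eve_config (foldl eve_next eve_start w)) foldl_rcons.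
move: (foldl _ _ w) h1 h2 => x h1 h2.
have h3 : eve_ok x by rewrite /eve_ok; case: x.1 h2 => // t [].
case: (eve_step ha h3) => [st|hh].
  left; split=> // _; case: x {h1 h2} st h3 => [[t|] m] /= st h3; last exact: final_sink.
  rewrite /eve_next /=; case E: verdict => [||d t'] /=; try exact: final_sink.
  by apply: final_refute; apply: verdict_ok E.
right; split=> [c st|[v [c hr hc]]].
  by case: (eve_step_uniq h3 st).
case: x h1 h2 h3 hh => [[t|] m] //= h1 [ht h2] _ hh.
have La := verdict_halt hh.
(* An accepting run starts in the chain or in the refute copy. In the first case a is a header
   outside the program, hence the last letter, and both checkers halt on [w ++ [:: a]]; in the
   second the run passes through the stuck configuration. *)
move: hr; rewrite cat_rcons /= => /run_consE[c1 /step_init[_ [] ->] hr].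
  have hN := run_letters hr.
  have hd := (run_chainP (leqnn X) hN).1 (ex_intro2 _ _ c hr hc).
  have v0 := halts_header La hd; rewrite {}v0 in hN hd hr.
  apply: nh; exists (w ++ [:: a]); split=> //.
  by apply: h2; rewrite halts_cons hh.
have /run_consE[c2 st _] := h1 _ _ hr.
by case: (@eve_step_uniq (Some t, m) a c2 ht st).
Qed.

(** * Well-formedness of the automaton *)

Lemma ctls_ok s : s \in ctls C M -> ok_ctl s.
Proof.
rewrite mem_cat => /orP[/allpairsP[[l r] [hl hr ->]]|/flatten_mapP[[v r] h1 /mapP[t ht ->]]].
  by move: hl hr; rewrite !mem_iota /= !add0n => -> ->.
have [[v1 r1] [hv hr [-> ->]]] := allpairsP h1.
by move: hv hr ht; rewrite !mem_iota /= add0n ltnS => -> -> ->.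
Qed.

Lemma delta_states x z a d y :
  x \in states C M -> (d, y) \in delta C x z a -> y \in states C M.
Proof.
rewrite mem_cat => /orP[|/allpairsP[[b s] [_ /ctls_ok /= hs ->]]].
  rewrite !inE => /or3P[] /eqP-> //=; last by rewrite inE => /eqP[_ ->].
  by case: ifP => // _; rewrite inE => /eqP[_ ->]; apply/mem_states/ok_up0.
case: b => /=; case E: verdict => [||d' s'] //=; rewrite inE => /eqP[_ ->] //;
  by apply: mem_states; apply: verdict_ok E.
Qed.

Lemma load_wf : wf_oca A.
Proof.
have iN : pickle sinit <= N := num_le init_state.
apply/and3P; split; first by rewrite /nQ /q0 /=; lia.
  apply/allP => q /mapP[x hx ->]; suff /num_le : x \in states C M by rewrite /nQ /=; lia.
  move: hx; rewrite 2!inE => /or3P[/eqP->|/eqP->|/mapP[s /ctls_ok hs ->]] //.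
  exact: mem_states.
apply/allP => t; rewrite /Delta /= inE mem_cat mem_rev => /or3P[/eqP->|/mapP[j hj ->]|].
- by apply/and4P; split=> //; rewrite /nQ /nS /t_src /t_letter /t_tgt /=; lia.
- move: hj; rewrite mem_iota => hj.
  by apply/and4P; split=> //; rewrite /nQ /nS /t_src /t_letter /t_tgt /=; lia.
- case/baseP => [x [z [a [d [y [hx ha hd ->]]]]]].
  have h1 := num_le hx; have h2 := num_le (delta_states hx hd).
  apply/and4P; rewrite /nQ /nS /t_src /t_letter /t_tgt /t_dir /=; split; try lia.
  (* [~~ z], read as a number, is a counter value that satisfies the guard z. *)
  move: hd; have -> : z = ((~~ z : nat) == 0) by case: z.
  by case/delta_dir.
Qed.

End LetterGame.

(** * Minsky machines as Collatz-like machines *)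

Definition mhalts (q : seq instr) (s : mstate) : Prop :=
  exists n, size q <= (iter n (mstep q) s).1.

Fixpoint nprime (n : nat) : nat :=
  if n is m.+1 then s2val (prime_above (nprime m)) else 2.

Lemma nprime_prime n : prime (nprime n).
Proof. by case: n => //= n; case: prime_above. Qed.

Lemma nprime_inj : injective nprime.
Proof.
have lt m n : m < n -> nprime m < nprime n.
  apply: (homo_ltn ltn_trans) => {m n} n /=; by case: prime_above.
move=> m n e; case: (ltngtP m n) => // /lt; rewrite e ltnn //.
Qed.

Definition godel (K : nat) (R : nat -> nat) : nat := \prod_(r < K) nprime r ^ R r.

Lemma godel_ext K R R' : R =1 R' -> godel K R = godel K R'.
Proof. by move=> e; apply: eq_bigr => r _; rewrite e. Qed.

Lemma godel_inc K R r : r < K -> godel K (upd R r (R r).+1) = nprime r * godel K R.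
Proof.
move=> rK; rewrite /godel (bigD1 (Ordinal rK)) //= [in RHS](bigD1 (Ordinal rK)) //=.
rewrite /upd eqxx expnS -mulnA; congr (_ * (_ * _)).
apply: eq_bigr => i ir; case: eqP => // e.
by case/eqP: ir; apply: val_inj.
Qed.

Lemma godel_dec K R r : r < K -> 0 < R r ->
  godel K R = nprime r * godel K (upd R r (R r).-1).
Proof.
move=> rK R0; rewrite -godel_inc //; apply: godel_ext => i.
by rewrite /upd eqxx prednK //; case: eqP => // ->.
Qed.

Lemma godel_dvd K R r : R r = 0 -> (nprime r %| godel K R) = false.
Proof.
move=> R0; rewrite /godel; elim: K => [|K IH].
  by rewrite big_ord0 dvdn1; have := nprime_prime r; case: eqP => // ->.
rewrite big_ord_recr /= Euclid_dvdM ?nprime_prime // IH /=.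
rewrite Euclid_dvdX ?nprime_prime // dvdn_prime2 ?nprime_prime //.
by apply/negP => /andP[/eqP/nprime_inj<-]; rewrite R0.
Qed.

Definition reg (i : instr) : nat := match i with Inc r _ => r | Dec r _ _ => r end.

(** [Inc] multiplies by the prime. [Dec] divides by it on remainder 0 and otherwise keeps the value.
    Targets are cut at [size q] for [next_le]. *)
Definition minsky_collatz (q : seq instr) : collatz := {|
  clen := size q;
  modulus := fun l =>
    match nth (Inc 0 0) q l with Inc _ _ => 1 | Dec r _ _ => nprime r end;
  factor := fun l d =>
    match nth (Inc 0 0) q l with
    | Inc r _ => nprime r
    | Dec r _ _ => if d == 0 then 1 else nprime r
    end;
  next := fun l d => minn (size q)
    match nth (Inc 0 0) q l with
    | Inc _ j => j
    | Dec _ j k => if d == 0 then j else k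
    end |}.

(** The extra [Inc 0 0] accounts for the default of [nth] at locations outside the program. *)
Definition regs (q : seq instr) : seq nat := [seq reg i | i <- Inc 0 0 :: q].

Lemma mem_regs q l : reg (nth (Inc 0 0) q l) \in regs q.
Proof.
case: (ltnP l (size q)) => h; last by rewrite nth_default ?mem_head.
by rewrite inE; apply/orP; right; rewrite -(nth_map _ 0) // mem_nth // size_map.
Qed.

Lemma minsky_collatz_wf q :
  collatz_wf (minsky_collatz q) (\max_(r <- regs q) nprime r).
Proof.
have pgt1 r : 1 < nprime r := prime_gt1 (nprime_prime r).
have bnd l : nprime (reg (nth (Inc 0 0) q l)) <= \max_(r <- regs q) nprime r.
  by apply: leq_bigmax_seq => //; exact: mem_regs.
split=> [l|l|l d|l d|l d] /=; last exact: geq_minl.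
- by case: nth => // r *; apply: ltnW.
- by have := bnd l; case: nth => [r j|r j k] //=; have := pgt1 r; lia.
- case: nth => [r j|r j k]; first by rewrite ltnS leqn0 => /eqP->; apply: ltnW.
  by case: eqP => // ->.
- have := bnd l; case: nth => [r j|r j k] //=; have := pgt1 r; case: ifP => //; lia.
Qed.

Definition encode (q : seq instr) (K : nat) (s : mstate) : nat * nat :=
  (minn (size q) s.1, godel K s.2).

Lemma collatz_step_encode q K s : {in regs q, forall r, r < K} ->
  s.1 < size q ->
  collatz_step (minsky_collatz q) (encode q K s) = encode q K (mstep q s).
Proof.
case: s => pc R hK /= h; have := hK _ (mem_regs q pc).
rewrite /collatz_step /encode /= h (minn_idPr (ltnW h)).
case: nth => [r j|r j k] /= rK.
  by rewrite modn1 divn1 addn0 godel_inc.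
case: (posnP (R r)) => R0.
  by rewrite -[_ %% _ == 0]/(nprime r %| _) godel_dvd //= mulnC -divn_eq.
by rewrite (godel_dec rK R0) modnMr mul1n addn0 mulKn ?prime_gt0 ?nprime_prime.
Qed.

Lemma mhaltsP q K s : {in regs q, forall r, r < K} ->
  mhalts q s <-> collatz_halts (minsky_collatz q) (encode q K s).
Proof.
move=> hK; split=> -[n].
  elim: n s => [|n IH] s hn.
    by exists 0; rewrite /= leq_min leqnn.
  case: (leqP (size q) s.1) => h; first by exists 0; rewrite /= leq_min leqnn.
  have [|k] := IH (mstep q s); first by rewrite -iterSr.
  by rewrite -collatz_step_encode // -iterSr => hk; exists k.+1.
elim: n s => [|n IH] s hn; first by exists 0; move: hn; rewrite /= leq_min leqnn.
case: (leqP (size q) s.1) => h; first by exists 0.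
have [|k] := IH (mstep q s); first by rewrite -collatz_step_encode // -iterSr.
by rewrite -iterSr => hk; exists k.+1.
Qed.

(** * Loop programs *)

Definition reach (p : seq instr) (x y : mstate) : Prop :=
  exists n, iter n (mstep p) x = y.

Lemma reach_refl p x : reach p x x. Proof. by exists 0. Qed.

Lemma reach_trans p x y z : reach p x y -> reach p y z -> reach p x z.
Proof. by move=> [m <-] [n <-]; exists (n + m); rewrite iterD. Qed.

Lemma reach_step p x : reach p x (mstep p x). Proof. by exists 1. Qed.

Definition code_at (p : seq instr) (o : nat) (c : seq instr) : Prop :=
  forall i, i < size c -> o + i < size p /\ nth (Inc 0 0) p (o + i) = nth (Inc 0 0) c i.

Lemma code_at_cat p o c1 c2 : code_at p o (c1 ++ c2) ->
  code_at p o c1 /\ code_at p (o + size c1) c2.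
Proof.
move=> h; split=> i hi.
  by have [] := h i; rewrite ?size_cat ?nth_cat ?hi; first lia.
have [] := h (size c1 + i); first by rewrite size_cat ltn_add2l.
by rewrite addnA nth_cat ifF ?addKn //; lia.
Qed.

Lemma code_at_cons p o i c : code_at p o (i :: c) ->
  [/\ o < size p, nth (Inc 0 0) p o = i & code_at p o.+1 c].
Proof.
move=> h; have [//|] := h 0; rewrite addn0 => h1 h2; split=> // j hj.
by have [//|] := h j.+1; rewrite addnS addSn.
Qed.

Lemma code_at_mid c1 c2 c3 : code_at (c1 ++ c2 ++ c3) (size c1) c2.
Proof.
move=> i hi; rewrite !size_cat nth_cat ifF; last lia.
by rewrite addKn nth_cat hi; split=> //; lia.
Qed.

Inductive cmd := Add (n r : nat) | Seq (c1 c2 : cmd) | Loop (r : nat) (c : cmd).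

Fixpoint avoids (r : nat) (c : cmd) : bool :=
  match c with
  | Add _ r' => r' != r
  | Seq c1 c2 => avoids r c1 && avoids r c2
  | Loop r' c => (r' != r) && avoids r c
  end.

(** As the body leaves the loop register alone, the number of rounds fixed on entry by [eval] agrees
    with the zero tests of the compiled code. *)
Fixpoint wf_cmd (c : cmd) : bool :=
  match c with
  | Add _ _ => true
  | Seq c1 c2 => wf_cmd c1 && wf_cmd c2
  | Loop r c => avoids r c && wf_cmd c
  end.

Fixpoint eval (c : cmd) (s : seq nat) : seq nat :=
  match c with
  | Add n r => set_nth 0 s r (nth 0 s r + n)
  | Seq c1 c2 => eval c2 (eval c1 s)
  | Loop r c =>
      iter (nth 0 s r) (fun t => eval c (set_nth 0 t r (nth 0 t r).-1)) s
  end.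

Fixpoint csize (c : cmd) : nat :=
  match c with
  | Add n _ => n
  | Seq c1 c2 => csize c1 + csize c2
  | Loop _ c => (csize c).+2
  end.

(** Addresses are absolute, starting from o. The last [Dec] of a loop repeats the test at its head
    and replaces a jump back. *)
Fixpoint compile (o : nat) (c : cmd) : seq instr :=
  match c with
  | Add n r => mkseq (fun i => Inc r (o + i).+1) n
  | Seq c1 c2 => compile o c1 ++ compile (o + csize c1) c2
  | Loop r c =>
      Dec r o.+1 (o + (csize c).+2) ::
      rcons (compile o.+1 c) (Dec r o.+1 (o + (csize c).+2))
  end.

Lemma size_compile o c : size (compile o c) = csize c.
Proof.
elim: c o => [n r|c1 IH1 c2 IH2|r c IH] o /=; first by rewrite size_mkseq.
  by rewrite size_cat IH1 IH2.
by rewrite size_rcons IH.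
Qed.

Lemma nth_eval_avoids r c s : avoids r c -> nth 0 (eval c s) r = nth 0 s r.
Proof.
elim: c s => [n r'|c1 IH1 c2 IH2|r' c IH] s /=.
- by move=> h; rewrite nth_set_nth /= eq_sym (negbTE h).
- by case/andP=> h1 h2; rewrite IH2 // IH1.
- case/andP=> h1 h2; elim: (nth 0 s r') => //= k; rewrite IH // nth_set_nth /=.
  by rewrite eq_sym (negbTE h1).
Qed.

Lemma compile_correct p o c R s : wf_cmd c -> code_at p o (compile o c) ->
  R =1 nth 0 s ->
  exists2 R', reach p (o, R) (o + csize c, R') & R' =1 nth 0 (eval c s).
Proof.
elim: c o R s => [n r|c1 IH1 c2 IH2|r c IH] o R s.
- move=> _ /= h Rs.
  suff H k : k <= n -> exists2 R', reach p (o, R) (o + k, R')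
      & R' =1 nth 0 (set_nth 0 s r (nth 0 s r + k)) by exact: H.
  elim: k => [|k IHk] hk.
    exists R; first by rewrite addn0; apply: reach_refl.
    by move=> i; rewrite Rs nth_set_nth /= addn0; case: eqP => // ->.
  have [R' h1 h2] := IHk (ltnW hk).
  exists (upd R' r (R' r).+1).
    apply: reach_trans h1 _; have [] := h k; first by rewrite size_mkseq.
    rewrite nth_mkseq // => h3 h4; have := reach_step p (o + k, R').
    by rewrite /= h3 h4 addnS.
  move=> i; rewrite /upd !h2 !nth_set_nth /= eqxx; case: eqP => // _.
  by rewrite addnS.
- move=> /= /andP[w1 w2] /code_at_cat[]; rewrite size_compile => a1 a2 Rs.
  have [R1 r1 e1] := IH1 _ _ _ w1 a1 Rs.
  have [R2 r2 e2] := IH2 _ _ _ w2 a2 e1.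
  by exists R2 => //; rewrite addnA; apply: reach_trans r1 r2.
- move=> /= /andP[av wc] /code_at_cons[h1 h2]; rewrite -cats1 => /code_at_cat[h3].
  rewrite size_compile => /code_at_cons[h4 h5 _] Rs.
  (* Stated for any pc that carries this [Dec], since the test stands at both ends of the loop. *)
  have loop pc R0 s0 : pc < size p ->
      nth (Inc 0 0) p pc = Dec r o.+1 (o + (csize c).+2) -> R0 =1 nth 0 s0 ->
      exists2 R', reach p (pc, R0) (o + (csize c).+2, R') &
        R' =1 nth 0 (iter (nth 0 s0 r)
                 (fun t => eval c (set_nth 0 t r (nth 0 t r).-1)) s0).
    move Ek: (nth 0 s0 r) => k; elim: k s0 pc R0 Ek => [|k IHk] s0 pc R0 Ek hp1 hp2 Rs0.
      exists R0 => //; have := reach_step p (pc, R0).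
      by rewrite /= hp1 hp2 Rs0 Ek.
    set s1 := set_nth 0 s0 r (nth 0 s0 r).-1.
    have e1 : upd R0 r (R0 r).-1 =1 nth 0 s1.
      by move=> i; rewrite /upd nth_set_nth /= !Rs0.
    have [R2 r2 e2] := IH _ _ _ wc h3 e1.
    have [||||R3 r3 e3] := IHk (eval c s1) (o.+1 + csize c) R2 => //.
      by rewrite nth_eval_avoids // /s1 nth_set_nth /= eqxx Ek.
    exists R3; last by rewrite iterSr.
    apply: reach_trans (reach_trans r2 r3).
    by have := reach_step p (pc, R0); rewrite /= hp1 hp2 Rs0 Ek.
  exact: loop.
Qed.

(** P is a memory with holes at registers r and t. For explicit lists the equations hold by
    computation, so programs can be evaluated symbolically. *)
Definition slots2 (P : nat -> nat -> seq nat) (r t : nat) : Prop :=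
  forall a b a', [/\ nth 0 (P a b) r = a, nth 0 (P a b) t = b,
                     set_nth 0 (P a b) r a' = P a' b
                   & set_nth 0 (P a b) t a' = P a a'].

Lemma eval_loop (T : Type) r c (P : nat -> T -> seq nat) g k x :
  (forall k x, nth 0 (P k x) r = k) ->
  (forall k x, eval c (set_nth 0 (P k.+1 x) r k) = P k (g x)) ->
  eval (Loop r c) (P k x) = P 0 (iter k g x).
Proof.
move=> h1 h2 /=; rewrite h1; elim: k x => // k IH x.
by rewrite iterSr h1 h2 IH -iterSr.
Qed.

(** * Loop programs for arithmetic and list codes *)

Definition transfer k r t : cmd := Loop r (Add k t).

Lemma eval_transfer k r t P a b : slots2 P r t ->
  eval (transfer k r t) (P a b) = P 0 (k * a + b).
Proof.
move=> h; rewrite (eval_loop (P := P) (g := addn k)).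
- by congr P; elim: a => [|a IH] /=; rewrite ?muln0 // IH mulnS addnA.
- by move=> x y; case: (h x y 0).
- move=> x y; case: (h x.+1 y x) => _ _ -> _ /=; case: (h x y (y + k)) => _ -> _ ->.
  by rewrite addnC.
Qed.

Definition multiply k r t : cmd := Seq (transfer k r t) (transfer 1 t r).

Lemma eval_multiply k r t P a : slots2 P r t ->
  eval (multiply k r t) (P a 0) = P (k * a) 0.
Proof.
move=> h; rewrite -[LHS]/(eval (transfer 1 t r) (eval (transfer k r t) _)).
rewrite eval_transfer // addn0 (eval_transfer _ _ _ (P := fun b a => P a b)).
  by rewrite mul1n addn0.
by move=> x y z; case: (h y x z).
Qed.

Definition multiply_pow k r t u : cmd := Loop u (multiply k r t).

Lemma eval_multiply_pow k r t u (P : nat -> nat -> nat -> seq nat) n a :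
  (forall n, slots2 (P n) r t) -> (forall t, slots2 (fun n a => P n a t) u r) ->
  eval (multiply_pow k r t u) (P n a 0) = P 0 (k ^ n * a) 0.
Proof.
move=> h1 h2; rewrite (eval_loop (P := fun n a => P n a 0) (g := muln k)).
- by congr P; elim: n => [|n IH]; rewrite ?mul1n //= IH expnS mulnA.
- by move=> x y; case: (h2 0 x y 0).
- by move=> x y; case: (h2 0 x.+1 y x) => _ _ -> _; rewrite eval_multiply.
Qed.

(** Register r is drained into both t and u, then restored from u. *)
Definition copy r t u : cmd := Seq (Loop r (Seq (Add 1 t) (Add 1 u))) (transfer 1 u r).

Lemma eval_copy r t u (P : nat -> nat -> nat -> seq nat) a b :
  (forall c, slots2 (fun a b => P a b c) r t) ->
  (forall b, slots2 (fun a c => P a b c) r u) ->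
  (forall a, slots2 (P a) t u) ->
  eval (copy r t u) (P a b 0) = P a (a + b) 0.
Proof.
move=> h1 h2 h3; 
rewrite -[LHS]/(eval (transfer 1 u r)
  (eval (Loop r (Seq (Add 1 t) (Add 1 u))) (P a b 0))).
rewrite (eval_loop (P := fun a x => P a x.1 x.2) (g := fun x => (x.1.+1, x.2.+1))
  _ (b, 0)).
- have -> : iter a (fun x => (x.1.+1, x.2.+1)) (b, 0) = (a + b, a).
    by elim: a => //= a ->.
  rewrite (eval_transfer 1 (P := fun c a => P a _ c)) ?mul1n ?addn0 //.
  by move=> x y z; case: (h2 (a + b) y x z).
- by move=> x y; case: (h1 y.2 x y.1 0).
- move=> x y; case: (h1 y.2 x.+1 y.1 x) => _ _ -> _ /=.
  case: (h1 y.2 x y.1 (y.1 + 1)) => _ -> _ ->.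
  by case: (h2 (y.1 + 1) x y.2 (y.2 + 1)) => _ -> _ ->; rewrite !addn1.
Qed.

(** The code of [n :: s] is 2^n (2 c + 1), where c is the code of s. *)
Definition push r t u : cmd := Seq (multiply 2 t u) (Seq (Add 1 t) (multiply_pow 2 t u r)).

Lemma eval_push r t u (P : nat -> nat -> nat -> seq nat) n s :
  (forall n, slots2 (P n) t u) -> (forall u, slots2 (fun n a => P n a u) r t) ->
  eval (push r t u) (P n (CodeSeq.code s) 0) = P 0 (CodeSeq.code (n :: s)) 0.
Proof.
move=> h1 h2.
rewrite -[LHS]/(eval (multiply_pow 2 t u r) (eval (Add 1 t) (eval (multiply 2 t u) _))).
rewrite eval_multiply // [eval (Add _ _) _]/=.
case: (h1 n (2 * CodeSeq.code s) 0 (2 * CodeSeq.code s + 1)) => -> _ -> _.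
by rewrite eval_multiply_pow // addn1 mul2n.
Qed.

(** * The program computing the code of the automaton *)

(* Registers: 0 N, 1 F, 2 D, 3 X, 4 result, 5 argument, 6 and 7 scratch, 8 N + i. *)
Definition pairing : cmd := Seq (push 5 7 6) (Seq (push 4 7 6) (transfer 1 7 4)).
Definition pairing_cst (n : nat) : cmd := Seq (Add n 5) pairing.

Lemma eval_seq c1 c2 s : eval (Seq c1 c2) s = eval c2 (eval c1 s).
Proof. by []. Qed.

(** A pair is pickled as a two-element list; register 7 starts at 0, the code of the empty list. *)
Lemma eval_pairing N F D X a t J :
  eval pairing [:: N; F; D; X; a; t; 0; 0; J]
  = [:: N; F; D; X; CodeSeq.code [:: a; t]; 0; 0; 0; J].
Proof.
rewrite 2!eval_seq.
rewrite (eval_push (P := fun n d u => [:: N; F; D; X; a; n; u; d; J]) t [::]) //.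
rewrite (eval_push (P := fun n d u => [:: N; F; D; X; n; 0; u; d; J]) a [:: t]) //.
rewrite (eval_transfer 1 (P := fun x y => [:: N; F; D; X; y; 0; 0; x; J])) //.
by rewrite mul1n addn0.
Qed.

Lemma eval_pairing_cst n N F D X a J :
  eval (pairing_cst n) [:: N; F; D; X; a; 0; 0; 0; J]
  = [:: N; F; D; X; CodeSeq.code [:: a; n]; 0; 0; 0; J].
Proof. by rewrite eval_seq -eval_pairing. Qed.

Lemma eval_copy_j N F D X a J :
  eval (copy 8 5 7) [:: N; F; D; X; a; 0; 0; 0; J]
  = [:: N; F; D; X; a; J; 0; 0; J].
Proof.
by rewrite (eval_copy (P := fun x y z => [:: N; F; D; X; a; y; 0; z; x])) ?addn0.
Qed.

Lemma eval_push_trans N F s X t J :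
  eval (push 4 2 6) [:: N; F; CodeSeq.code s; X; t; 0; 0; 0; J]
  = [:: N; F; CodeSeq.code (t :: s); X; 0; 0; 0; 0; J].
Proof.
by rewrite (eval_push (P := fun n d u => [:: N; F; d; X; n; 0; u; 0; J])).
Qed.

(** Register 4 holds the source and register 8 the target; guard, letter and update are
    constants. *)
Definition push_trans (a : nat) : cmd :=
  Seq (pairing_cst (pickle true)) (Seq (pairing_cst a)
  (Seq (pairing_cst (pickle (0%R : int))) (Seq (copy 8 5 7) (Seq pairing (push 4 2 6))))).

Lemma pickle_seq (T : countType) (s : seq T) :
  pickle s = CodeSeq.code (map pickle s).
Proof. by []. Qed.

Lemma pickle_cons (T : countType) (x : T) (s : seq T) :
  pickle (x :: s) = CodeSeq.code (pickle x :: map pickle s).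
Proof. by []. Qed.

Lemma pickle_trans q z a d q' : pickle ((q, z, a, d, q') : trans) =
  CodeSeq.code [:: CodeSeq.code [:: CodeSeq.code [:: CodeSeq.code
    [:: q; pickle z]; a]; pickle d]; q'].
Proof. by []. Qed.

Lemma pickle_oca n m q (F : seq nat) (D : seq trans) : pickle ((n, m, q, F, D) : oca) =
  CodeSeq.code [:: CodeSeq.code [:: CodeSeq.code [:: CodeSeq.code
    [:: n; m]; q]; pickle F]; pickle D].
Proof. by []. Qed.

Lemma eval_push_trans_pickle N F D X q a J :
  eval (push_trans a) [:: N; F; pickle D; X; q; 0; 0; 0; J]
  = [:: N; F; pickle ((q, true, a, 0%R, J) :: D : seq trans); X; 0; 0; 0; 0; J].
Proof.
rewrite 5!eval_seq !eval_pairing_cst eval_copy_j eval_pairing.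
by rewrite pickle_cons pickle_trans pickle_seq eval_push_trans.
Qed.

Definition load_power (k : nat) : cmd :=
  Seq (copy k 5 7) (multiply_pow (nprime k) 3 6 5).

Lemma eval_load_powers N F D :
  eval (Seq (load_power 0) (Seq (load_power 1) (load_power 2)))
    [:: N; F; D; 1; 0; 0; 0; 0; 0]
  = [:: N; F; D; nprime 2 ^ D * (nprime 1 ^ F * nprime 0 ^ N); 0; 0; 0; 0; 0].
Proof.
rewrite -[LHS]/(eval (multiply_pow (nprime 2) 3 6 5) (eval (copy 2 5 7)
  (eval (multiply_pow (nprime 1) 3 6 5) (eval (copy 1 5 7)
  (eval (multiply_pow (nprime 0) 3 6 5) (eval (copy 0 5 7)
   [:: N; F; D; 1; 0; 0; 0; 0; 0])))))).
rewrite (eval_copy (P := fun x y z => [:: x; F; D; 1; 0; y; 0; z; 0])) // addn0.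
rewrite (eval_multiply_pow _ (P := fun x y z => [:: N; F; D; y; 0; x; z; 0; 0])) //.
rewrite muln1; move: (nprime 0 ^ N) => x0.
rewrite (eval_copy (P := fun x y z => [:: N; x; D; x0; 0; y; 0; z; 0])) // addn0.
rewrite (eval_multiply_pow _ (P := fun x y z => [:: N; F; D; y; 0; x; z; 0; 0])) //.
move: (nprime 1 ^ F * x0) => x1.
rewrite (eval_copy (P := fun x y z => [:: N; F; x; x1; 0; y; 0; z; 0])) // addn0.
by rewrite (eval_multiply_pow _ (P := fun x y z => [:: N; F; D; y; 0; x; z; 0; 0])).
Qed.

(** Register 8 climbs from N to N + X; the latest transition comes first, whence the [rev] in
    [load]. *)
Definition push_chain : cmd :=
  Loop 3 (Seq (copy 8 4 7) (Seq (Add 1 4) (Seq (push_trans 0) (Add 1 8)))).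

Lemma eval_push_chain N F D X :
  eval push_chain [:: N; F; pickle D; X; 0; 0; 0; 0; N]
  = [:: N; F; pickle (rev [seq chain N i | i <- iota 0 X] ++ D : seq trans);
        0; 0; 0; 0; 0; N + X].
Proof.
pose P k (x : seq trans * nat) := [:: N; F; pickle x.1; k; 0; 0; 0; 0; x.2].
pose g (x : seq trans * nat) := ((x.2.+1, true, 0, 0%R, x.2) :: x.1 : seq trans, x.2.+1).
have gE : iter X g (D, N) = (rev [seq chain N i | i <- iota 0 X] ++ D, N + X).
  elim: X => [|X IH]; first by rewrite addn0.
  rewrite iterS IH -[X.+1]addn1 iotaD map_cat rev_cat /g /= /chain add0n addnS.
  by rewrite addn1 addnS.
rewrite -[LHS]/(eval push_chain (P X (D, N))) (eval_loop (g := g)) // ?gE //.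
move=> k [D' J]; rewrite 3!eval_seq.
rewrite (eval_copy (P := fun x y z => [:: N; F; pickle D'; k; y; 0; 0; z; x])) // addn0.
rewrite [eval (Add 1 4) _]/= addn1 eval_push_trans_pickle.
by rewrite [eval _ _]/= addn1.
Qed.

(** The program does not contain its own text: N, F, D are read from registers 0 to 2. Register 3
    starts at 1, the empty product, and becomes X; then come the chain, the entry edge and the
    nested pairs of the tuple. *)
Definition quine : cmd :=
  Seq (Add 1 3)
 (Seq (Seq (load_power 0) (Seq (load_power 1) (load_power 2)))
 (Seq (copy 0 8 7)
 (Seq push_chain
 (Seq (Add (pickle sinit) 4)
 (Seq (push_trans 1)
 (Seq (transfer 1 8 4) (Seq (Add 1 4) (Seq (transfer 1 0 5) (Seq pairing
 (Seq (pairing_cst (pickle sinit))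
 (Seq (transfer 1 1 5) (Seq pairing
 (Seq (transfer 1 2 5) (Seq pairing
 (transfer 1 4 0))))))))))))))).

Lemma wf_quine : wf_cmd quine. Proof. by []. Qed.

(** The Gödel code of the initial registers, hence the initial value of the Collatz-like machine. *)
Definition chain_length (N F D : nat) : nat :=
  nprime 2 ^ D * (nprime 1 ^ F * nprime 0 ^ N).

Lemma eval_quine N (F : seq nat) (D : seq trans) :
  eval quine [:: N; pickle F; pickle D; 0; 0; 0; 0; 0; 0]
  = [:: pickle (load N (chain_length N (pickle F) (pickle D)) F D);
        0; 0; 0; 0; 0; 0; 0; 0].
Proof.
set X := chain_length _ _ _.
do 2!rewrite eval_seq.
rewrite -[eval (Add 1 3) _]/[:: N; pickle F; pickle D; 1; 0; 0; 0; 0; 0].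
rewrite eval_load_powers -/X.
do 1!rewrite eval_seq.
rewrite (eval_copy (P := fun x y z => [:: x; pickle F; pickle D; X; 0; 0; 0; z; y])) // addn0.
rewrite eval_seq eval_push_chain eval_seq.
set D' := rev _ ++ D.
rewrite -[eval (Add _ 4) _]/[:: N; pickle F; pickle D'; 0; pickle sinit; 0; 0; 0; N + X].
rewrite eval_seq eval_push_trans_pickle.
set D'' := (_ :: D').
have -> : pickle (load N X F D) = CodeSeq.code [:: CodeSeq.code [:: CodeSeq.code
    [:: CodeSeq.code [:: (N + X).+1; N]; pickle sinit]; pickle F]; pickle D''].
  exact: pickle_oca.
move: (pickle F) (pickle D'') (N + X) => f d J; move: (pickle sinit) => i {D' D'' X}.
do 2!rewrite eval_seq.
rewrite (eval_transfer 1 (P := fun x y => [:: N; f; d; 0; y; 0; 0; 0; x])) //.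
rewrite [eval (Add 1 4) _]/= mul1n addn0 addn1.
do 2!rewrite eval_seq.
rewrite (eval_transfer 1 (P := fun x y => [:: x; f; d; 0; J.+1; y; 0; 0; 0])) //.
rewrite mul1n addn0 eval_pairing eval_seq eval_pairing_cst.
do 2!rewrite eval_seq; move: (CodeSeq.code _) => e.
rewrite (eval_transfer 1 (P := fun x y => [:: 0; x; d; 0; e; y; 0; 0; 0])) //.
rewrite mul1n addn0 eval_pairing.
do 2!rewrite eval_seq; move: (CodeSeq.code [:: e; f]) => e'.
rewrite (eval_transfer 1 (P := fun x y => [:: 0; 0; x; 0; e'; y; 0; 0; 0])) //.
rewrite mul1n addn0 eval_pairing.
rewrite (eval_transfer 1 (P := fun x y => [:: y; 0; 0; 0; x; 0; 0; 0; 0])) //.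
by rewrite mul1n addn0.
Qed.

(** * Diagonalization *)

(** Jumps that leave p are redirected to the address just after its copy. *)
Definition relocate (o : nat) (p : seq instr) : seq instr :=
  [seq match i with
       | Inc r j => Inc r (o + minn j (size p))
       | Dec r j k => Dec r (o + minn j (size p)) (o + minn k (size p))
       end | i <- p].

Lemma relocate_reach q o p pc R R' n :
  code_at q o (relocate o p) -> R =1 R' ->
  let s := iter n (mstep p) (pc, R) in
  exists2 R'', s.2 =1 R'' &
    reach q (o + minn pc (size p), R') (o + minn s.1 (size p), R'').
Proof.
move=> hq; elim: n pc R R' => [|n IH] pc R R' e.
  by exists R' => //; apply: reach_refl.
rewrite iterSr /=; case hpc: (pc < size p); last exact: IH.
have [] := hq pc; first by rewrite size_map.
rewrite (nth_map (Inc 0 0)) // => h1 h2.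
have st := reach_step q (o + minn pc (size p), R').
have updE r v v' : v = v' -> upd R r v =1 upd R' r v'.
  by move=> -> i; rewrite /upd e.
rewrite (minn_idPl (ltnW hpc)) /= h1 h2 in st *.
case: nth st => [r j|r j k] st.
  have [R'' e' h] := IH j _ _ (updE r _ _ (congr1 succn (e r))).
  by exists R'' => //; apply: reach_trans h.
rewrite -e in st; case: eqP st => h0 st.
  have [R'' e' h] := IH k _ _ e.
  by exists R'' => //; apply: reach_trans h.
have [R'' e' h] := IH j _ _ (updE r _ _ (erefl (R r).-1)).
by exists R'' => //; apply: reach_trans h.
Qed.

(** A halted state is a fixed point of [mstep], so halting passes both ways along a run. *)
Lemma mhalts_reach q x y : reach q x y -> mhalts q x <-> mhalts q y.
Proof.
move=> [m <-]; split=> -[n hn]; last by exists (n + m); rewrite iterD.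
exists n; rewrite -iterD addnC iterD; move: (iter n _ x) hn => s hs.
suff -> : iter m (mstep q) s = s by [].
elim: m => //= m ->; case: s hs => pc R /= hs.
by rewrite ltnNge hs.
Qed.

(** The last instruction loops on itself; the exit [o.+3] is taken only by the second test, when
    register 0 held 1. *)
Definition halt_if_one (o : nat) : seq instr :=
  [:: Dec 0 o.+1 o.+2; Dec 0 o.+2 o.+3; Dec 0 o.+2 o.+2].

Lemma halt_if_oneP q o R : size q = o.+3 -> code_at q o (halt_if_one o) ->
  mhalts q (o, R) <-> R 0 = 1.
Proof.
move=> sq /code_at_cons[h1 e1 /code_at_cons[h2 e2 /code_at_cons[h3 e3 _]]].
have stuck R' : ~ mhalts q (o.+2, R').
  case=> n; suff [R'' ->] : exists R'', iter n (mstep q) (o.+2, R') = (o.+2, R'').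
    by rewrite sq ltnn.
  elim: n => [|n [R'' IH]]; first by exists R'.
  rewrite iterS IH /= h3 e3; case: ifP => _; first by exists R''.
  by exists (upd R'' 0 (R'' 0).-1).
have := mhalts_reach (reach_step q (o, R)); rewrite /= h1 e1 => ->.
case E0: (R 0) => [|v] /=; first by split=> // /stuck.
have := mhalts_reach (reach_step q (o.+1, upd R 0 v)); rewrite /= h2 e2 => ->.
rewrite /upd /=; case: v E0 => [|v] E0 /=; last by split=> // /stuck.
by split=> // _; exists 0; rewrite sq.
Qed.

Definition halts_iff_one (c : cmd) (p : seq instr) : seq instr :=
  compile 0 c ++ relocate (csize c) p ++ halt_if_one (csize c + size p).

Lemma size_halts_iff_one c p : size (halts_iff_one c p) = (csize c + size p).+3.
Proof. by rewrite !size_cat size_compile size_map /=; lia. Qed.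

Lemma halts_iff_oneP c p x a n : wf_cmd c -> nth 0 (eval c x) =1 (minit a).2 ->
  let s := iter n (mstep p) (minit a) in
  size p <= s.1 ->
  mhalts (halts_iff_one c p) (0, nth 0 x) <-> s.2 0 = 1.
Proof.
move=> wfc xa s hs; set q := halts_iff_one c p.
have at1 : code_at q 0 (compile 0 c) by exact: (code_at_mid [::]).
have at2 : code_at q (csize c) (relocate (csize c) p).
  have := @code_at_mid (compile 0 c) (relocate (csize c) p)
    (halt_if_one (csize c + size p)).
  by rewrite size_compile.
have at3 : code_at q (csize c + size p) (halt_if_one (csize c + size p)).
  have := @code_at_mid (compile 0 c ++ relocate (csize c) p)
    (halt_if_one (csize c + size p)) [::].
  by rewrite cats0 -catA size_cat size_compile size_map.
have [R1 r1 e1] := compile_correct wfc at1 (frefl (nth 0 x)).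
have e2 : (minit a).2 =1 R1 by move=> i; rewrite e1 xa.
have [R2 e3 r2] := relocate_reach 0 n at2 e2.
rewrite -/(minit a) -/s in e3 r2.
rewrite (mhalts_reach r1) add0n; move: r2; rewrite min0n addn0 => r2.
rewrite (mhalts_reach r2) (minn_idPr hs) e3; apply: halt_if_oneP at3.
exact: size_halts_iff_one.
Qed.

Theorem theorem6 :
  ~ exists p : seq instr, decides p history_deterministic.
Proof.
case=> p dec.
(* There is no circularity: q depends on p alone, the automaton on q, and N, F, D reach q only as
   initial registers. *)
pose q := halts_iff_one quine p; pose C := minsky_collatz q.
pose M := \max_(r <- regs q) nprime r.
(* Above every pickled state and every header, the largest being [(clen C).+1]. *)
pose N := (\max_(x <- states C M) pickle x).+1 + (clen C).+2.
pose F := accepting C M N; pose D := base C M N.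
pose X := chain_length N (pickle F) (pickle D).
have wfC : collatz_wf C M := minsky_collatz_wf q.
have L0 : 0 < clen C by rewrite /C [clen _]size_halts_iff_one.
have LN : (clen C).+1 < N by rewrite /N; lia.
have numN : all (fun x : state => pickle x < N) (states C M).
  apply/allP => x hx; rewrite /N ltn_addr // ltnS.
  exact: (leq_bigmax_seq x hx isT).
have [n [hs hHD]] := dec _ (load_wf X wfC L0 LN numN).
have self := eval_quine N F D; rewrite -/X in self.
have init : nth 0 (eval quine [:: N; pickle F; pickle D; 0; 0; 0; 0; 0; 0])
    =1 (minit (pickle (load N X F D))).2.
  rewrite self; move: (pickle (load _ _ _ _)) => a.
  by do 9?[case=> //] => i; rewrite /= nth_nil.
have := halts_iff_oneP wf_quine init hs.
(* At least 3, so that the data registers split off as the first three factors of [godel]. *)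
pose K := (\max_(r <- regs q) r).+3.
have hK : {in regs q, forall r, r < K}.
  by move=> r hr; rewrite /K !ltnS; apply: leqW; apply: leqW; exact: (leq_bigmax_seq r hr isT).
rewrite -/q (mhaltsP _ hK) /encode /= minn0.
have -> : godel K (nth 0 [:: N; pickle F; pickle D; 0; 0; 0; 0; 0; 0]) = X.
  rewrite (godel_ext _ (R' := nth 0 [:: N; pickle F; pickle D])); last first.
    by do 9?[case=> //] => i; rewrite /= !nth_nil.
  rewrite /godel /K !big_ord_recl /= big1 ?muln1; last by move=> i _; rewrite nth_nil.
  by rewrite mulnC -mulnA mulnCA.
rewrite (collatz_haltsP X wfC L0 LN) -/C => hh.
have [hd1 hd2] := load_hdP X wfC L0 LN numN.
(* A halting word means answer 1, hence history-determinism, which excludes halting words; their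
   absence gives history-determinism, hence answer 1 and a halting word. *)
have nh : ~ _ := fun e => hd1 (hHD.1 (hh.1 e)) e.
exact: nh (hh.2 (hHD.2 (hd2 nh))).
Qed.
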